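(* Let $\chi$ be a Dirichlet character modulo $N$ (not necessarily primitive) and let $\boldsymbol{\chi}=(\chi_p)$ be the corresponding character on $\mathbb{A}_{\mathbb{Q}}^{\times}/\mathbb{Q}^{\times}$. Let $a\in\mathbb{Z}$ be non-zero, and for a prime $q$ let $\nu_q(a)$ denote the exponent of the highest power of $q$ dividing $a$. (a) If $q$ is a prime with $q\nmid N$, then $\chi_q(a)=\chi(q)^r$ where $r=\nu_q(a)$. (b) Suppose $q$ is a prime dividing $N$ and let $q_1,\dots,q_r$ be the other primes dividing $N$. Let $b$ be a positive integer satisfying $$b\equiv a \pmod{aN\mathbb{Z}_q},\qquad b\equiv 1\pmod{N\mathbb{Z}_{q_i}}\quad (i=1,\dots,r).$$ Write the prime factorization of $b$ as $$b=q^{\nu_q(a)}\prod_{j=1}^{s}\ell_j^{\beta_j},$$ where the $\ell_j$ are distinct primes. Then $$\chi_q(a)=\prod_{j=1}^{s}\chi(\ell_j)^{-\beta_j}.$$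
   Context: Correspondence between Dirichlet characters and Hecke characters: if $\boldsymbol{\chi}=(\chi_p)$ is a character of finite order of $\mathbb{A}_{\mathbb{Q}}^{\times}/\mathbb{Q}^{\times}$ (with local components $\chi_p$ on $\mathbb{Q}_p^\times$, $p$ running over all places), there exist an integer $N'$ whose prime divisors are precisely the finite primes $p$ at which $\chi_p$ is ramified (i.e. non-trivial on $\mathbb{Z}_p^\times$), and a primitive Dirichlet character $\chi$ modulo $N'$ such that $\chi(p)=\chi_p(p)$ for every finite prime $p\nmid N'$. The map $\boldsymbol{\chi}\mapsto\chi$ is a bijection between finite order characters of $\mathbb{A}_{\mathbb{Q}}^{\times}/\mathbb{Q}^{\times}$ and primitive Dirichlet characters. For a not necessarily primitive Dirichlet character, the corresponding $\boldsymbol{\chi}$ is the one corresponding to the primitive character inducing it. *)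

(* Defs.v *)
From HB Require Import structures.
From mathcomp Require Import all_boot all_order all_algebra.
From mathcomp Require Import all_classical all_reals all_analysis.
From mathcomp Require Import complex.

Set Implicit Arguments.
Unset Strict Implicit.
Unset Printing Implicit Defensive.

Import Order.TTheory GRing.Theory Num.Theory.
Import numFieldNormedType.Exports.

Local Open Scope classical_set_scope.
Local Open Scope ring_scope.

Record prime_number := PrimeNumber {
  prime_val :> nat;
  prime_valP : prime prime_val }.

HB.instance Definition _ := [isSub for prime_val].
HB.instance Definition _ := [Countable of prime_number by <:].

(* The transition map Z/M -> Z/m, used for m dividing M. *)
Definition Zp_red (m M : nat) (x : 'Z_M) : 'Z_m := (x : nat)%:R.

Section ZpRed.
Variables m M : nat.
Hypotheses (m_gt1 : (1 < m)%N) (M_gt1 : (1 < M)%N) (dvd_mM : (m %| M)%N).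

Lemma Zp_red_nat k : Zp_red m (k%:R : 'Z_M) = k%:R.
Proof.
rewrite /Zp_red val_Zp_nat // -(Zp_nat_mod m_gt1) (modn_dvdm _ dvd_mM).
exact: Zp_nat_mod.
Qed.

Lemma Zp_redD (x y : 'Z_M) : Zp_red m (x + y) = Zp_red m x + Zp_red m y.
Proof. by rewrite -[x]natr_Zp -[y]natr_Zp -natrD !Zp_red_nat natrD. Qed.

Lemma Zp_redM (x y : 'Z_M) : Zp_red m (x * y) = Zp_red m x * Zp_red m y.
Proof. by rewrite -[x]natr_Zp -[y]natr_Zp -natrM !Zp_red_nat natrM. Qed.

Lemma Zp_redN (x : 'Z_M) : Zp_red m (- x) = - Zp_red m x.
Proof.
apply/eqP; rewrite -addr_eq0 -Zp_redD addNr.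
by rewrite -[X in Zp_red m X](mulr0n 1) Zp_red_nat.
Qed.

End ZpRed.

(* Z_p as the inverse limit of the rings Z/p^(n+1): the exponent starts at 1
   because 'Z_1 is not the zero ring. *)
Record padic_int (p : prime_number) := PadicInt {
  padic_digits :> forall n : nat, 'Z_(p ^ n.+1);
  padic_compat : forall n, Zp_red (p ^ n.+1) (padic_digits n.+1) = padic_digits n }.

HB.instance Definition _ p := gen_eqMixin (padic_int p).
HB.instance Definition _ p := gen_choiceMixin (padic_int p).

Section PadicIntRing.
Variable p : prime_number.
Local Notation Zp := (padic_int p).

Lemma padic_intP (x y : Zp) : (forall n, x n = y n) -> x = y.
Proof.
case: x y => [x hx] [y hy] /= exy.
have e : x = y by apply: functional_extensionality_dep.
by case: _ / e hy => hy; congr PadicInt; apply: Prop_irrelevance.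
Qed.

Lemma ppow_gt1 n : (1 < p ^ n.+1)%N.
Proof. by rewrite -[X in (X < _)%N](exp1n n.+1) ltn_exp2r // prime_gt1 ?prime_valP. Qed.

Lemma ppow_dvd n : (p ^ n.+1 %| p ^ n.+2)%N.
Proof. exact: dvdn_exp2l. Qed.

Lemma padic_nat_compat k n :
  Zp_red (p ^ n.+1) (k%:R : 'Z_(p ^ n.+2)) = k%:R.
Proof. by rewrite Zp_red_nat ?ppow_gt1 ?ppow_dvd. Qed.

Lemma padic_add_compat (x y : Zp) n :
  Zp_red (p ^ n.+1) (x n.+1 + y n.+1) = x n + y n.
Proof. by rewrite Zp_redD ?ppow_gt1 ?ppow_dvd // !padic_compat. Qed.

Lemma padic_mul_compat (x y : Zp) n :
  Zp_red (p ^ n.+1) (x n.+1 * y n.+1) = x n * y n.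
Proof. by rewrite Zp_redM ?ppow_gt1 ?ppow_dvd // !padic_compat. Qed.

Lemma padic_opp_compat (x : Zp) n : Zp_red (p ^ n.+1) (- x n.+1) = - x n.
Proof. by rewrite Zp_redN ?ppow_gt1 ?ppow_dvd // !padic_compat. Qed.

Definition padic_int_zero : Zp := PadicInt (padic_nat_compat 0).
Definition padic_int_one : Zp := PadicInt (padic_nat_compat 1).
Definition padic_int_add (x y : Zp) : Zp := PadicInt (padic_add_compat x y).
Definition padic_int_mul (x y : Zp) : Zp := PadicInt (padic_mul_compat x y).
Definition padic_int_opp (x : Zp) : Zp := PadicInt (padic_opp_compat x).

Lemma padic_int_addA : associative padic_int_add.
Proof. by move=> x y z; apply: padic_intP => n /=; rewrite addrA. Qed.
Lemma padic_int_addC : commutative padic_int_add.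
Proof. by move=> x y; apply: padic_intP => n /=; rewrite addrC. Qed.
Lemma padic_int_add0 : left_id padic_int_zero padic_int_add.
Proof. by move=> x; apply: padic_intP => n /=; rewrite add0r. Qed.
Lemma padic_int_addN : left_inverse padic_int_zero padic_int_opp padic_int_add.
Proof. by move=> x; apply: padic_intP => n /=; rewrite addNr. Qed.

HB.instance Definition _ := GRing.isZmodule.Build Zp
  padic_int_addA padic_int_addC padic_int_add0 padic_int_addN.

Lemma padic_int_mulA : associative padic_int_mul.
Proof. by move=> x y z; apply: padic_intP => n /=; rewrite mulrA. Qed.
Lemma padic_int_mulC : commutative padic_int_mul.
Proof. by move=> x y; apply: padic_intP => n /=; rewrite mulrC. Qed.
Lemma padic_int_mul1 : left_id padic_int_one padic_int_mul.
Proof. by move=> x; apply: padic_intP => n /=; rewrite mul1r. Qed.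
Lemma padic_int_mulDl : left_distributive padic_int_mul padic_int_add.
Proof. by move=> x y z; apply: padic_intP => n /=; rewrite mulrDl. Qed.
Lemma padic_int_one_neq0 : padic_int_one != 0.
Proof.
apply/eqP => /(congr1 (fun x : Zp => x 0%N)) /= /eqP.
by rewrite oner_eq0.
Qed.

HB.instance Definition _ := GRing.Zmodule_isComNzRing.Build Zp
  padic_int_mulA padic_int_mulC padic_int_mul1 padic_int_mulDl
  padic_int_one_neq0.

Definition padic_int_unit : {pred Zp} := [pred x : Zp | `[< exists y, y * x = 1 >]].
Definition padic_int_inv (x : Zp) : Zp :=
  if pselect (exists y, y * x = 1) is left h then projT1 (cid h) else x.

Lemma padic_int_mulVx :
  {in padic_int_unit, left_inverse 1 padic_int_inv *%R}.
Proof.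
move=> x /asboolP h; rewrite /padic_int_inv; case: pselect => // h'.
by case: cid.
Qed.

Lemma padic_int_unitPl (x y : Zp) : y * x = 1 -> padic_int_unit x.
Proof. by move=> h; apply/asboolP; exists y. Qed.

Lemma padic_int_invr_out : {in [predC padic_int_unit], padic_int_inv =1 id}.
Proof.
move=> x /asboolP h; rewrite /padic_int_inv; case: pselect => // h'.
Qed.

HB.instance Definition _ := GRing.ComNzRing_hasMulInverse.Build Zp
  padic_int_mulVx padic_int_unitPl padic_int_invr_out.

Lemma padic_digit_mod (x : Zp) n d :
  (x (n + d)%N : nat) = x n %[mod p ^ n.+1].
Proof.
elim: d => [|d <-]; first by rewrite addn0.
rewrite addnS -[x (n + d)%N]padic_compat /Zp_red val_Zp_nat ?ppow_gt1 //.
by rewrite modn_dvdm // dvdn_exp2l // ltnS leq_addr.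
Qed.

Lemma padic_digit_eq0 (x : Zp) n d :
  (p ^ n.+1 %| x (n + d)%N)%N -> x n = 0.
Proof.
rewrite /dvdn padic_digit_mod => /eqP h.
by rewrite -[x n]natr_Zp -(Zp_nat_mod (ppow_gt1 n)) h.
Qed.

Lemma padic_int_unitE (x : Zp) : (x \is a GRing.unit) = (x 0%N \is a GRing.unit).
Proof.
apply/idP/idP => [/mulVr/(congr1 (fun z : Zp => z 0%N)) h|x0].
  by apply/unitrP; exists (x^-1 0%N); split=> //; rewrite mulrC.
have xn n : x n \is a GRing.unit.
  move: x0; rewrite -[x n]natr_Zp -[x 0%N]natr_Zp !unitZpE ?ppow_gt1 //.
  rewrite !coprime_pexpl // -coprime_modr.
  have mod1 (a b : nat) : a = b %[mod p ^ 1] -> a = b %[mod p] by rewrite expn1.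
  have /mod1 e := padic_digit_mod x 0 n.
  rewrite -e.
  by rewrite coprime_modr.
have compat n : Zp_red (p ^ n.+1) (x n.+1)^-1 = (x n)^-1.
  apply: (mulIr (xn n)); rewrite [RHS](mulVr (xn n)). rewrite -[X in _ * X]padic_compat.
  rewrite -Zp_redM ?ppow_gt1 ?ppow_dvd // (mulVr (xn n.+1)).
  exact: (padic_nat_compat 1).
apply/unitrP; exists (PadicInt compat).
by split; apply: padic_intP => n; [apply: mulVr|apply: mulrV]; apply: xn.
Qed.

Lemma padic_digit0_p (z : Zp) : (p%:R * z) 0%N = 0.
Proof.
rewrite mulr_natl -(mulr0n (z 0%N)).
have -> k : (z *+ k) 0%N = z 0%N *+ k.
  by elim: k => // k; rewrite !mulrS => <-.
rewrite mulr0n -mulr_natl -(Zp_nat_mod (ppow_gt1 0)).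
by have -> : (p %% p ^ 1 = 0)%N; rewrite ?expn1 ?modnn // mul0r.
Qed.

Lemma padic_int_mulf_eq0 (x y : Zp) : x * y = 0 -> (x == 0) || (y == 0).
Proof.
move=> xy0; apply/orP; apply: contrapT => /not_orP[/negP nx /negP ny].
have nz (z : Zp) : z != 0 -> exists n, z n != 0.
  move=> nz; apply: contrapT => h; move/eqP: nz; apply; apply: padic_intP => n.
  by apply/eqP; apply: contrapT => /negP hn; apply: h; exists n.
have [m xm] := nz _ nx; have [n yn] := nz _ ny.
have ppr := prime_valP p.
pose K := (m + n).+1.
have xK : ~~ (p ^ m.+1 %| x K)%N.
  by apply: contra xm; rewrite /K -addnS => /padic_digit_eq0 ->.
have yK : ~~ (p ^ n.+1 %| y K)%N.
  by apply: contra yn; rewrite /K -addSn addnC => /padic_digit_eq0 ->.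
have x_gt0 : (0 < x K)%N by rewrite lt0n; apply: contra xK => /eqP ->.
have y_gt0 : (0 < y K)%N by rewrite lt0n; apply: contra yK => /eqP ->.
have : x K * y K = 0 by apply: (congr1 (fun z : Zp => z K) xy0).
rewrite -[x K]natr_Zp -[y K]natr_Zp -natrM.
move/(congr1 (fun i : 'Z__ => i : nat)); rewrite val_Zp_nat ?ppow_gt1 //.
move/eqP; rewrite -/(dvdn _ _).
rewrite pfactor_dvdn ?muln_gt0 ?x_gt0 // lognM //.
move: xK yK; rewrite !pfactor_dvdn // -!ltnNge !ltnS => hx hy.
by rewrite /K ltnNge (leq_trans (leq_add hx hy)) // leqnSn.
Qed.

HB.instance Definition _ :=
  GRing.ComUnitRing_isIntegral.Build Zp padic_int_mulf_eq0.

End PadicIntRing.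

(* Q_p, as the field of fractions of Z_p. *)
Definition padic (p : prime_number) := {fraction padic_int p}.

HB.instance Definition _ p := GRing.Field.on (padic p).

Definition Zp_unit (p : prime_number) : set (padic p) :=
  [set x | exists2 u : padic_int p, u \is a GRing.unit & x = tofrac u].

Definition padic_open (p : prime_number) (A : set (padic p)) : Prop :=
  forall x, A x -> exists n : nat,
    forall z : padic_int p, A (x + p%:R ^+ n * tofrac z).

Section PadicTopology.
Variable p : prime_number.

Lemma padic_openT : padic_open (@setT (padic p)).
Proof. by move=> x _; exists 0%N. Qed.

Lemma padic_openI : setI_closed (@padic_open p).
Proof.
have mono (A : set (padic p)) x n m : (n <= m)%N ->
    (forall z : padic_int p, A (x + p%:R ^+ n * tofrac z)) ->
    forall z : padic_int p, A (x + p%:R ^+ m * tofrac z).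
  move=> /subnKC <- h z; have := h (p%:R ^+ (m - n) * z).
  by rewrite rmorphM rmorphXn /= rmorph_nat exprD mulrA.
move=> A B oA oB x [/oA[n hn] /oB[m hm]]; exists (maxn n m) => z; split.
  exact: mono (leq_maxl _ _) hn z.
exact: mono (leq_maxr _ _) hm z.
Qed.

Lemma padic_open_bigU (I : Type) (f : I -> set (padic p)) :
  (forall i, padic_open (f i)) -> padic_open (\bigcup_i f i).
Proof.
by move=> o x [i _ /o[n hn]]; exists n => z; exists i.
Qed.

HB.instance Definition _ := isOpenTopological.Build (padic p)
  padic_openT padic_openI padic_open_bigU.

End PadicTopology.

(* The idele group A_Q^x: the restricted product of the Q_p^x with respect to
   the Z_p^x, times R^x. *)
Record idele (R : realType) := Idele {
  fin_part :> forall p : prime_number, padic p;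
  inf_part : R;
  fin_part_neq0 : forall p, fin_part p != 0;
  inf_part_neq0 : inf_part != 0;
  fin_part_unit : finite_set [set p | ~ Zp_unit (fin_part p)] }.

HB.instance Definition _ R := gen_eqMixin (idele R).
HB.instance Definition _ R := gen_choiceMixin (idele R).

Section IdeleGroup.
Variable R : realType.
Local Notation idele := (idele R).

Lemma ideleP (x y : idele) :
  (forall p, x p = y p) -> inf_part x = inf_part y -> x = y.
Proof.
case: x y => [x a hx ha fx] [y b hy hb fy] /= exy eab.
have e : x = y by apply: functional_extensionality_dep.
by case: _ / e eab hy hb fy => <- *; congr Idele; apply: Prop_irrelevance.
Qed.

Lemma Zp_unit1 p : Zp_unit (1 : padic p).
Proof. by exists 1; rewrite ?unitr1 ?rmorph1. Qed.

Lemma Zp_unitM p (x y : padic p) : Zp_unit x -> Zp_unit y -> Zp_unit (x * y).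
Proof.
move=> [u hu ->] [v hv ->]; exists (u * v); first by rewrite unitrM hu.
by rewrite rmorphM.
Qed.

Lemma Zp_unitV p (x : padic p) : Zp_unit x -> Zp_unit x^-1.
Proof.
move=> [u hu ->]; exists u^-1; first by rewrite unitrV.
by rewrite rmorphV.
Qed.

Lemma idele_one_subproof :
  finite_set [set p | ~ Zp_unit (1 : padic p)].
Proof.
rewrite [X in finite_set X](_ : _ = set0) //; apply/seteqP; split=> // p /=.
by move/(_ (Zp_unit1 p)).
Qed.

Definition idele_one : idele :=
  Idele (fun=> oner_neq0 _) (oner_neq0 R) idele_one_subproof.

Lemma idele_mul_fin (x y : idele) p : x p * y p != 0.
Proof. by rewrite mulf_neq0 ?fin_part_neq0. Qed.

Lemma idele_mul_inf (x y : idele) : inf_part x * inf_part y != 0.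
Proof. by rewrite mulf_neq0 ?inf_part_neq0. Qed.

Lemma idele_mul_unit (x y : idele) :
  finite_set [set p | ~ Zp_unit (x p * y p)].
Proof.
apply: (@sub_finite_set _ _
  ([set p | ~ Zp_unit (x p)] `|` [set p | ~ Zp_unit (y p)])).
  move=> p /= h; apply: contrapT => /not_orP[/contrapT hx /contrapT hy].
  exact: h (Zp_unitM hx hy).
by rewrite finite_setU; split; apply: fin_part_unit.
Qed.

Definition idele_mul (x y : idele) : idele :=
  Idele (idele_mul_fin x y) (idele_mul_inf x y) (idele_mul_unit x y).

Lemma idele_inv_fin (x : idele) p : (x p)^-1 != 0.
Proof. by rewrite invr_eq0 fin_part_neq0. Qed.

Lemma idele_inv_inf (x : idele) : (inf_part x)^-1 != 0.
Proof. by rewrite invr_eq0 inf_part_neq0. Qed.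

Lemma idele_inv_unit (x : idele) :
  finite_set [set p | ~ Zp_unit (x p)^-1].
Proof.
apply: sub_finite_set (fin_part_unit x) => p /= h hx; exact: h (Zp_unitV hx).
Qed.

Definition idele_inv (x : idele) : idele :=
  Idele (idele_inv_fin x) (idele_inv_inf x) (idele_inv_unit x).

Lemma idele_mulA : associative idele_mul.
Proof. by move=> x y z; apply: ideleP => [p|] /=; rewrite mulrA. Qed.
Lemma idele_mul1x : left_id idele_one idele_mul.
Proof. by move=> x; apply: ideleP => [p|] /=; rewrite mul1r. Qed.
Lemma idele_mulx1 : right_id idele_one idele_mul.
Proof. by move=> x; apply: ideleP => [p|] /=; rewrite mulr1. Qed.
Lemma idele_mulVx : left_inverse idele_one idele_inv idele_mul.
Proof.
by move=> x; apply: ideleP => [p|] /=; rewrite mulVf ?fin_part_neq0 ?inf_part_neq0.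
Qed.
Lemma idele_mulxV : right_inverse idele_one idele_inv idele_mul.
Proof.
by move=> x; apply: ideleP => [p|] /=; rewrite divff ?fin_part_neq0 ?inf_part_neq0.
Qed.

HB.instance Definition _ := isGroup.Build idele
  idele_mulA idele_mul1x idele_mulx1 idele_mulVx idele_mulxV.

(* Basic open sets of the restricted product topology: a product of open sets
   of the local factors, equal to Z_p^x at almost every p. *)
Definition idele_box (U : forall p, set (padic p)) (V : set R) : set idele :=
  [set x : idele | (forall p, U p (x p)) /\ V (inf_part x)].

Definition idele_open (A : set idele) : Prop :=
  forall x, A x -> exists (U : forall p, set (padic p)) (V : set R),
    [/\ forall p, open (U p), open V,
        finite_set [set p | U p <> @Zp_unit p],
        idele_box U V x & idele_box U V `<=` A].

Lemma Zp_unit_padic_open p : padic_open (@Zp_unit p).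
Proof.
move=> _ [u hu ->]; exists 1%N => z; exists (u + p%:R * z); last first.
  by rewrite rmorphD rmorphM rmorph_nat expr1.
move: hu; rewrite !padic_int_unitE.
rewrite -[(u + _) 0%N]/(u 0%N + (p%:R * z) 0%N).
by rewrite padic_digit0_p addr0.
Qed.

Lemma Zp_unit_open p : open (@Zp_unit p).
Proof. exact: Zp_unit_padic_open. Qed.

Lemma idele_openT : idele_open setT.
Proof.
move=> x _.
exists (fun p => if pselect (Zp_unit (x p)) then @Zp_unit p else setT), setT.
split=> //.
- by move=> p; case: (pselect (Zp_unit (x p))) => h; [exact: Zp_unit_open|exact: openT].
- exact: openT.
- by apply: sub_finite_set (fin_part_unit x) => p /=; case: (pselect (Zp_unit (x p))).
- by split=> // p; case: (pselect (Zp_unit (x p))).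
Qed.

Lemma idele_openI : setI_closed idele_open.
Proof.
move=> A B oA oB x [Ax Bx].
have [U [V [oU oV fU [xU xV] sUA]]] := oA x Ax.
have [U' [V' [oU' oV' fU' [xU' xV'] sUB]]] := oB x Bx.
exists (fun p => U p `&` U' p), (V `&` V'); split.
- by move=> p; apply: openI.
- exact: openI.
- apply: (@sub_finite_set _ _
    ([set p | U p <> @Zp_unit p] `|` [set p | U' p <> @Zp_unit p])).
    move=> p /= h; apply: contrapT => /not_orP[/contrapT e /contrapT e'].
    by apply: h; rewrite e e' setIid.
  by rewrite finite_setU.
- by split.
- move=> y [yU [yV yV']]; split; [apply: sUA|apply: sUB]; split=> // p.
    by case: (yU p).
  by case: (yU p).
Qed.

Lemma idele_open_bigU (I : Type) (f : I -> set idele) :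
  (forall i, idele_open (f i)) -> idele_open (\bigcup_i f i).
Proof.
move=> o x [i _ /o[U [V [oU oV fU xU sU]]]]; exists U, V; split=> //.
by move=> y /sU; exists i.
Qed.

HB.instance Definition _ := isOpenTopological.Build idele
  idele_openT idele_openI idele_open_bigU.

Lemma local_idele_fin p (x : padic p) (hx : x != 0) p' :
  eqtype.dfwith (fun q => 1 : padic q) x p' != 0.
Proof.
have [<-|ne] := eqVneq p p'; first by rewrite dfwith_in.
by rewrite dfwith_out // oner_neq0.
Qed.

Lemma local_idele_unit p (x : padic p) :
  finite_set [set q | ~ Zp_unit (eqtype.dfwith (fun q => 1 : padic q) x q)].
Proof.
apply: (@sub_finite_set _ _ [set p]) => // q /= h.
apply: contrapT => /eqP; rewrite eq_sym => ne; apply: h.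
by rewrite dfwith_out //; apply: Zp_unit1.
Qed.

Definition local_idele p (x : padic p) (hx : x != 0) : idele :=
  Idele (local_idele_fin hx) (oner_neq0 R) (local_idele_unit x).

Definition principal_idele : set idele :=
  [set x : idele | exists c : rat,
     (forall p, x p = ratr c) /\ inf_part x = ratr c].

End IdeleGroup.

HB.instance Definition _ (R : realType) := NormedModule.copy R[i] R[i]^o.

(* A finite order character of A_Q^x/Q^x, seen as a character of A_Q^x that is
   trivial on Q^x.  Continuity is for the norm topology of R[i]; the values are
   nonzero by [hecke_finite_order]. *)
Record finite_order_hecke_character (R : realType) (X : idele R -> R[i]) : Prop := {
  hecke_mul : forall x y, X (x * y)%g = X x * X y;
  hecke_continuous : continuous X;
  hecke_principal : forall x, principal_idele x -> X x = 1;
  hecke_finite_order : exists2 n : nat, (0 < n)%N & forall x, X x ^+ n = 1 }.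

(* The local component at p, as a function on Q_p extended by 0 at 0. *)
Definition local_component (R : realType) (X : idele R -> R[i])
    (p : prime_number) (x : padic p) : R[i] :=
  if pselect (x != 0) is left hx then X (local_idele R hx) else 0.

Definition ramified_at (R : realType) (X : idele R -> R[i])
    (p : prime_number) : Prop :=
  exists2 x : padic p, Zp_unit x & local_component X x != 1.

Record dirichlet_character (R : realType) (N : nat) (chi : int -> R[i]) : Prop := {
  dirichlet_modulus : (0 < N)%N;
  dirichlet_periodic : forall m n : int, (m = n %[mod N])%Z -> chi m = chi n;
  dirichlet_mul : forall m n : int, chi (m * n) = chi m * chi n;
  dirichlet_support : forall m : int, (chi m != 0) = coprimez m N }.

(* [chi], of modulus N, is induced by [chi'], of modulus M. *)
Definition dirichlet_induced (R : realType) (N : nat) (chi : int -> R[i])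
    (M : nat) (chi' : int -> R[i]) : Prop :=
  (M %| N)%N /\ forall m : int, coprimez m N -> chi m = chi' m.

Definition primitive_dirichlet_character (R : realType) (N : nat)
    (chi : int -> R[i]) : Prop :=
  dirichlet_character N chi /\
  forall (M : nat) (chi' : int -> R[i]), dirichlet_character M chi' ->
    dirichlet_induced N chi M chi' -> M = N.

Definition corresponds_primitive (R : realType) (X : idele R -> R[i])
    (N : nat) (chi : int -> R[i]) : Prop :=
  [/\ primitive_dirichlet_character N chi,
      forall p : prime_number, (p %| N)%N <-> ramified_at X p &
      forall p : prime_number, ~~ (p %| N)%N ->
        chi p%:Z = local_component X (p%:R : padic p)].

Definition corresponds (R : realType) (X : idele R -> R[i])
    (N : nat) (chi : int -> R[i]) : Prop :=
  exists (M : nat) (chi' : int -> R[i]),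
    dirichlet_induced N chi M chi' /\ corresponds_primitive X M chi'.

(* a = b mod c Z_q *)
Definition eqmod_padic (q : prime_number) (a b c : int) : Prop :=
  exists z : padic_int q, a%:~R - b%:~R = c%:~R * z.

(* Main.v *)
Require Import Defs.
From mathcomp Require Import all_boot all_order all_algebra.
From mathcomp Require Import all_classical all_reals all_analysis.
From mathcomp Require Import complex.

Set Implicit Arguments.
Unset Strict Implicit.
Unset Printing Implicit Defensive.

Import Order.TTheory GRing.Theory Num.Theory.

Local Open Scope ring_scope.

(** Let [D n] be the idele whose component at each prime dividing [N] is the
    positive integer [n], all other components being 1. Everything follows from
    one identity, [hecke_diagonal_coprime]: for [n] prime to [N],
    [X (D n) * chi n = 1]. By multiplicativity it suffices to treat a prime [n];
    then the principal idele [n], on which [X] is 1, is the product of [D n], of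
    the local uniformizer at [n], whose image is [chi n], and of an idele that is
    a unit wherever [X] is unramified, 1 at the divisors of [N] and positive at
    infinity. On such ideles [X] is trivial, by continuity, finite order and
    unramifiedness ([hecke_finite_level]).

    The identity bounds the conductor ([hecke_conductor]): [X] is trivial on an
    idele [y] whose components at the divisors of [N] are 1 modulo [N].
    Continuity gives this modulo some multiple [M] of [N]; approximating [y]
    modulo [M] by an integer [n] congruent to 1 modulo [N] brings it down to [N],
    because [X (D n) = (chi n)^-1 = 1].

    When [q] does not divide [N], [a] is a power of [q] times a unit at [q], and
    the value of the local component can be read off. When [q] divides [N], the
    congruences on [b] say that [D b] and [a] placed at [q] have the same image
    under [X]. The primes dividing [N] contribute nothing to [X (D b)], so if [m]
    is the part of [b] prime to [q], the common value is [(chi m)^-1]. *)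

(** * Approximation and divisibility in the ring of p-adic integers *)

Section PadicIntegers.
Variable p : prime_number.
Implicit Types x z : padic_int p.

Lemma padic_int_natE k n : (k%:R : padic_int p) n = k%:R.
Proof. by elim: k => // k IH; rewrite [in RHS]mulrS -IH mulrS. Qed.

Lemma padic_int_nat_unit k :
  coprime p k -> (k%:R : padic_int p) \is a GRing.unit.
Proof.
by move=> cpk; rewrite padic_int_unitE padic_int_natE unitZpE ?ppow_gt1.
Qed.

(** The digits of the quotient are obtained by shifting those of [x] by [k + 1]
    places; they stay compatible because the congruence between consecutive
    digits of [x] may be divided by the common factor. *)
Lemma padic_int_digit_eq0_dvd x k :
  x k = 0 -> exists z, x = (p ^ k.+1)%:R * z.
Proof.
move=> xk0.
have dvdx n : (p ^ k.+1 %| x (n + k)%N)%N.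
  by rewrite /dvdn addnC padic_digit_mod xk0 mod0n.
pose d n : 'Z_(p ^ n.+1) := ((x (n + k.+1)%N : nat) %/ p ^ k.+1)%:R.
have dvdx' n : (p ^ k.+1 %| x (n + k.+1)%N)%N by rewrite addnS -addSn.
have pk0 : (0 < p ^ k.+1)%N by rewrite ltnW ?ppow_gt1.
have eqd n : (x (n.+1 + k.+1)%N : nat) %/ p ^ k.+1
    = (x (n + k.+1)%N : nat) %/ p ^ k.+1 %[mod p ^ n.+1].
  apply/eqP; rewrite -(eqn_pmul2r pk0) !muln_modl // -expnD !divnK //.
  have e m : (x m.+1 : nat) = x m %[mod p ^ m.+1].
    by have := padic_digit_mod x m 1; rewrite addn1.
  have dv : (p ^ (n.+1 + k.+1) %| p ^ (n + k.+1).+1)%N by rewrite addSn.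
  by rewrite -(modn_dvdm _ dv) (e (n + k.+1)%N) modn_dvdm.
have compat n : Zp_red (p ^ n.+1) (d n.+1) = d n.
  by rewrite /d padic_nat_compat -(Zp_nat_mod (ppow_gt1 p n)) eqd
    Zp_nat_mod ?ppow_gt1.
exists (PadicInt compat); apply: padic_intP => n.
rewrite -[RHS]/(((p ^ k.+1)%:R : padic_int p) n * d n) padic_int_natE /d
  -natrM mulnC divnK //.
rewrite -(Zp_nat_mod (ppow_gt1 p n)) padic_digit_mod.
by rewrite Zp_nat_mod ?ppow_gt1 // natr_Zp.
Qed.

Lemma padic_int_approx x k :
  exists (n : nat) z, x = n%:R + (p ^ k.+1)%:R * z.
Proof.
have [|z xz] := @padic_int_digit_eq0_dvd (x - (x k : nat)%:R) k.
  have -> : (x - (x k : nat)%:R) k = x k - ((x k : nat)%:R : padic_int p) k.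
    by [].
  by rewrite padic_int_natE natr_Zp subrr.
by exists (x k : nat), z; rewrite -xz addrC subrK.
Qed.

(** Integers embed in the p-adic integers without gaining divisibility: it is
    enough to read the digit of index [k - 1], which lives modulo [p ^ k]. *)
Lemma padic_int_dvd_int (m : int) k z :
  m%:~R = (p ^ k)%:R * z -> (p ^ k %| `|m|)%N.
Proof.
case: k => [|k]; first by rewrite dvd1n.
have nat_case (n : nat) z' : n%:R = (p ^ k.+1)%:R * z' -> (p ^ k.+1 %| n)%N.
  move=> /(congr1 (fun x : padic_int p => x k)).
  rewrite padic_int_natE.
  rewrite -[X in _ = X]/(((p ^ k.+1)%:R : padic_int p) k * z' k).
  rewrite padic_int_natE -(Zp_nat_mod (ppow_gt1 p k) (p ^ k.+1)) modnn mul0r.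
  move=> /(congr1 (fun i : 'Z__ => i : nat)).
  by rewrite val_Zp_nat ?ppow_gt1 // => /eqP.
case: m => n.
- rewrite absz_nat -pmulrn; exact: nat_case.
- rewrite NegzE mulrNz -pmulrn => /(congr1 -%R); rewrite opprK -mulrN abszN.
  exact: nat_case.
Qed.

Lemma padic_int_nat_neq0 k : (0 < k)%N -> (k%:R : padic_int p) != 0.
Proof.
move=> k_gt0; apply/eqP => k0.
have := @padic_int_dvd_int k k 0; rewrite mulr0 -pmulrn => /(_ k0).
move=> /(dvdn_leq k_gt0); rewrite leqNgt ltn_expl //.
exact: prime_gt1 (prime_valP p).
Qed.

(** The part of [m] prime to [p] is invertible, so [m] generates the same ideal
    as the power of [p] that it contains. *)
Lemma padic_int_nat_dvd m k : (0 < m)%N -> (logn p m <= k)%N ->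
  exists z : padic_int p, (p ^ k)%:R = m%:R * z.
Proof.
move=> m_gt0 le_mk.
have [m' co_pm' m_eq] := pfactor_coprime (prime_valP p) m_gt0.
exists ((p ^ (k - logn p m))%:R / m'%:R); rewrite {1}m_eq.
rewrite -{1}(subnK le_mk) expnD !natrM [RHS]mulrC mulrA.
by rewrite divrK ?padic_int_nat_unit.
Qed.

End PadicIntegers.

(** * Roots of unity near 1, and congruences between integers *)

(** An [n]-th root of unity other than 1 satisfies [sum_(i < n) w ^ i = 0],
    which is impossible when every [w ^ i] is close to 1. This discreteness
    turns continuity of a finite order character into local constancy. *)
Lemma root_of_unity_near1 (C : numFieldType) (n : nat) (w : C) :
  w ^+ n = 1 -> `|1 - w| < n%:R^-1 -> w = 1.
Proof.
case: n => [|n] wn near1.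
  by move: near1; rewrite invr0 normr_lt0.
have w1 : `|w| = 1.
  by apply/eqP; rewrite -(@pexpr_eq1 _ _ n.+1) // -normrX wn normr1.
apply/eqP; rewrite -subr_eq0; apply/negP => /negP w_neq1.
have sum0 : \sum_(i < n.+1) w ^+ i = 0.
  apply/eqP; have := subrX1 w n.+1; rewrite wn subrr => /esym/eqP.
  by rewrite mulf_eq0 (negbTE w_neq1).
have pow_near i : (i < n.+1)%N -> `|1 - w ^+ i| <= n%:R * `|1 - w|.
  move=> lt_in; rewrite -normrN opprB subrX1 normrM mulrC distrC.
  apply: ler_wpM2r => //; apply: le_trans (ler_norm_sum _ _ _) _.
  under eq_bigr do rewrite normrX w1 expr1n.
  by rewrite sumr_const card_ord ler_nat.
have : n.+1%:R <= \sum_(i < n.+1) (n%:R * `|1 - w|).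
  have -> : n.+1%:R = `|\sum_(i < n.+1) (1 - w ^+ i)|.
    by rewrite sumrB sum0 subr0 sumr_const card_ord normr_nat.
  apply: le_trans (ler_norm_sum _ _ _) _.
  by apply: ler_sum => i _; apply: pow_near.
rewrite sumr_const card_ord -[X in _ <= X]mulr_natl.
rewrite -[X in X <= _]mulr1 ler_pM2l ?ltr0n //.
move=> le1; have : n.+1%:R * `|1 - w| < 1.
  by rewrite mulrC -ltr_pdivlMr ?ltr0n // mul1r.
move=> /(le_lt_trans (ler_wpM2r (normr_ge0 _) _)) => /(_ n%:R).
by rewrite ler_nat leqnSn => /(_ isT)/(le_lt_trans le1); rewrite ltxx.
Qed.

Lemma nat_eqmod (A : comPzRingType) (m n d : nat) :
  m = n %[mod d] -> exists w : A, m%:R = n%:R + d%:R * w.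
Proof.
move=> e; exists ((m %/ d)%:R - (n %/ d)%:R).
rewrite {1}(divn_eq m d) {1}(divn_eq n d) e !natrD !natrM mulrBr.
by rewrite ![d%:R * _]mulrC addrAC [_ + (_ - _)]addrC subrK.
Qed.

Lemma chinese_primes (s : seq prime_number) (c e : prime_number -> nat) :
  uniq s -> exists2 n, (0 < n)%N & forall p, p \in s -> n = c p %[mod p ^ e p].
Proof.
move=> uniq_s.
elim: s uniq_s => [|p s IH] /=; first by exists 1%N.
move=> /andP[p_notin /IH[n n_gt0 en]].
pose m := (\prod_(q <- s) q ^ e q)%N.
have m_gt0 : (0 < m)%N.
  by apply: prodn_gt0 => q; rewrite expn_gt0 prime_gt0 ?prime_valP.
have co_pm : coprime (p ^ e p) m.
  rewrite /m big_seq; elim/big_ind: _ => [||q q_in].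
  - exact: coprimen1.
  - by move=> a b; rewrite coprimeMr => -> ->.
  rewrite coprimeXl // coprimeXr // prime_coprime ?prime_valP //.
  rewrite dvdn_prime2 ?prime_valP //; apply: contra p_notin => /eqP epq.
  by rewrite (val_inj epq : p = q).
(* The second summand only makes the solution positive. *)
exists (chinese (p ^ e p) m (c p) n + p ^ e p * m)%N.
  rewrite addn_gt0; apply/orP; right.
  by rewrite muln_gt0 m_gt0 expn_gt0 prime_gt0 ?prime_valP.
move=> q; rewrite inE => /predU1P[->|q_in].
  by rewrite mulnC addnC modnMDl; apply: chinese_modl.
rewrite -en //.
have dvd_qm : (q ^ e q %| m)%N by rewrite /m (big_rem q) //= dvdn_mulr.
have /dvdnP[d ->] : (q ^ e q %| p ^ e p * m)%N by rewrite dvdn_mull.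
rewrite addnC modnMDl -(modn_dvdm _ dvd_qm) chinese_modr //.
exact: modn_dvdm.
Qed.

(** * Ideles and finite order characters *)

Section Ideles.
Variable R : realType.
Implicit Types (P : pred prime_number) (x y : idele R).

Lemma restrict_neq0 P x p : (if P p then x p else 1) != 0.
Proof. by case: ifP; rewrite ?fin_part_neq0 ?oner_neq0. Qed.

Lemma restrict_unit P x :
  finite_set [set p | ~ Zp_unit (if P p then x p else 1)].
Proof.
apply: sub_finite_set (fin_part_unit x) => p /=.
by case: ifP => // _ /(_ (Zp_unit1 p)).
Qed.

(** The archimedean component is always replaced by 1: only the sign matters
    there, and it is dealt with separately. *)
Definition restrict P x : idele R :=
  Idele (restrict_neq0 P x) (oner_neq0 R) (restrict_unit P x).

Lemma restrictM P x y : restrict P (x * y)%g = (restrict P x * restrict P y)%g.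
Proof.
by apply: ideleP => [p|] /=; rewrite ?mulr1 //; case: ifP; rewrite ?mulr1.
Qed.

Lemma diagonal_neq0 n p : (0 < n)%N -> n%:R != 0 :> padic p.
Proof.
move=> n_gt0; rewrite -(rmorph_nat (@tofrac _)) tofrac_eq0.
exact: padic_int_nat_neq0.
Qed.

Lemma Zp_unit_nat n (p : prime_number) :
  ~~ (p %| n)%N -> Zp_unit (n%:R : padic p).
Proof.
move=> p_ndvd; exists n%:R; last by rewrite rmorph_nat.
by rewrite padic_int_nat_unit ?prime_coprime ?prime_valP.
Qed.

Lemma diagonal_unit n : (0 < n)%N ->
  finite_set [set p : prime_number | ~ Zp_unit (n%:R : padic p)].
Proof.
move=> n_gt0.
apply: (@sub_finite_set _ _ (prime_val @^-1` `I_n.+1)) => [p /= nunit|].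
  rewrite ltnS dvdn_leq //; apply: contrapT => /negP p_ndvd.
  exact: nunit (Zp_unit_nat p_ndvd).
by apply: finite_preimage; [move=> p q _ _; apply: val_inj|apply: finite_II].
Qed.

Lemma diagonal_inf_neq0 n : (0 < n)%N -> n%:R != 0 :> R.
Proof. by rewrite pnatr_eq0 -lt0n. Qed.

Definition diagonal n (n_gt0 : (0 < n)%N) : idele R :=
  Idele (fun p => diagonal_neq0 p n_gt0) (diagonal_inf_neq0 n_gt0)
        (diagonal_unit n_gt0).

Lemma diagonalM m n (m_gt0 : (0 < m)%N) (n_gt0 : (0 < n)%N)
    (mn_gt0 : (0 < m * n)%N) :
  diagonal mn_gt0 = (diagonal m_gt0 * diagonal n_gt0)%g.
Proof. by apply: ideleP => [p|] /=; rewrite natrM. Qed.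

Lemma diagonal_principal n (n_gt0 : (0 < n)%N) :
  principal_idele (diagonal n_gt0).
Proof. by exists n%:R; split=> [p|] /=; rewrite ratr_nat. Qed.

Definition archimedean (c : R) (c_neq0 : c != 0) : idele R :=
  Idele (fun p => oner_neq0 (padic p)) c_neq0 idele_one_subproof.

(** The congruence subgroup of ideles of level [M], where the primes that carry
    a congruence condition are the divisors of [N]. Keeping [N] and [M] apart
    allows the level to grow while the set of primes stays the same. *)
Definition congruence_idele (N M : nat) (y : idele R) : Prop :=
  [/\ 0 < inf_part y,
      forall p : prime_number, ~~ (p %| N)%N -> Zp_unit (y p) &
      forall p : prime_number, (p %| N)%N ->
        exists z : padic_int p, y p = tofrac (1 + M%:R * z)].

Section Character.
Variable X : idele R -> R[i].

Lemma restrict1E (y : idele R) p :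
  X (restrict (pred1 p) y) = local_component X (y p).
Proof.
rewrite /local_component; case: pselect => [hx|]; last by rewrite fin_part_neq0.
congr X; apply: ideleP => // q /=; have [->|q_neq] := eqVneq q p.
  by rewrite dfwith_in.
by rewrite dfwith_out // eq_sym.
Qed.

Hypothesis X_hecke : finite_order_hecke_character X.

Lemma hecke1 : X 1%g = 1.
Proof.
apply: (hecke_principal X_hecke); exists 1%:R.
by split=> [p|]; rewrite ratr_nat.
Qed.

Lemma hecke_neq0 x : X x != 0.
Proof.
apply/eqP => Xx0; have := hecke1.
by rewrite -(mulgV x) (hecke_mul X_hecke) Xx0 mul0r => /esym/eqP;
  rewrite oner_eq0.
Qed.

Lemma heckeV x : X x^-1%g = (X x)^-1.
Proof.
apply: (mulfI (hecke_neq0 x)).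
by rewrite -(hecke_mul X_hecke) mulgV hecke1 divff ?hecke_neq0.
Qed.

(** A positive real is an [n]-th power for every [n], in particular for an
    [n] that kills the character. *)
Lemma hecke_archimedean (c : R) (c_neq0 : c != 0) :
  0 < c -> X (archimedean c_neq0) = 1.
Proof.
move=> c_gt0; have [n n_gt0 Xn] := hecke_finite_order X_hecke.
pose d := c `^ n%:R^-1.
have d_neq0 : d != 0 by rewrite gt_eqF // powR_gt0.
have -> : archimedean c_neq0 = ((archimedean d_neq0) ^+ n)%g.
  have powE k : inf_part (archimedean d_neq0 ^+ k)%g = d ^+ k /\
      forall p, (archimedean d_neq0 ^+ k)%g p = 1.
    elim: k => [//|k [IH1 IH2]]; rewrite expgS; split=> [|p].
      by rewrite exprS -IH1.
    by rewrite -[LHS]/(1 * (archimedean d_neq0 ^+ k)%g p) IH2 mulr1.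
  have [e1 e2] := powE n; apply: ideleP => [p|]; first by rewrite e2.
  rewrite e1 /= /d -powR_mulrn ?powR_ge0 // -powRrM mulVf ?pnatr_eq0 -?lt0n //.
  by rewrite powRr1 // ltW.
have -> k x : X (x ^+ k)%g = X x ^+ k.
  elim: k => [|k IH]; first exact: hecke1.
  by rewrite expgS (hecke_mul X_hecke) IH exprS.
exact: Xn.
Qed.

Lemma hecke_restrictT y : 0 < inf_part y -> X (restrict predT y) = X y.
Proof.
move=> y_gt0.
have -> : y = (archimedean (inf_part_neq0 y) * restrict predT y)%g.
  by apply: ideleP => [p|] /=; rewrite ?mul1r ?mulr1.
rewrite (hecke_mul X_hecke) hecke_archimedean // mul1r; congr X.
by apply: ideleP => [p|] /=; rewrite ?mul1r ?mulr1.
Qed.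

(** Components on which the character is locally trivial may be replaced by 1,
    finitely many at a time; continuity takes care of all the others. *)
Lemma hecke_drop (s : seq prime_number) y :
  (forall p, p \in s -> X (restrict (pred1 p) y) = 1) ->
  X (restrict [predC s] y) = X (restrict predT y).
Proof.
elim: s => [|p s IH] Xs; first by congr X; apply: ideleP.
rewrite -IH; last by move=> q q_in; apply: Xs; rewrite inE q_in orbT.
have [p_in|p_notin] := boolP (p \in s).
  congr X; apply: ideleP => // q /=; rewrite inE.
  by have [->|] := eqVneq q p; rewrite ?p_in.
have -> : restrict [predC s] y
    = (restrict (pred1 p) y * restrict [predC p :: s] y)%g.
  apply: ideleP => [q|] /=; rewrite ?mulr1 // inE.
  have [->|_] := eqVneq q p; first by rewrite p_notin mulr1.
  by rewrite mul1r.
by rewrite (hecke_mul X_hecke) Xs ?mul1r ?inE ?eqxx.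
Qed.

(** The roots of unity of bounded order are discrete, so that the preimage of 1
    under [X] is open. *)
Lemma hecke_trivial_box :
  exists (U : forall p, set (padic p)) (V : set R),
    [/\ forall p, padic_open (U p),
        finite_set [set p | U p <> @Zp_unit p],
        idele_box U V 1%g &
        forall x, idele_box U V x -> X x = 1].
Proof.
have [n n_gt0 Xn] := hecke_finite_order X_hecke.
have near1 : nbhs (1 : R[i]) [set w | w ^+ n = 1 -> w = 1]%classic.
  apply/nbhs_ballP; exists n%:R^-1 => /=; first by rewrite invr_gt0 ltr0n.
  by move=> w w_near wn; apply: (root_of_unity_near1 wn).
have := hecke_continuous X_hecke (x := 1%g); rewrite /continuous_at hecke1.
move=> /(_ _ near1); rewrite nbhsE => -[B [oB B1] subB].
have [U [V [oU oV finU box1 subU]]] := (oB : idele_open B) 1%g B1.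
exists U, V; split=> //.
by move=> x /subU/subB; apply.
Qed.

Lemma local_componentM p (x y : padic p) : x != 0 -> y != 0 ->
  local_component X (x * y) = local_component X x * local_component X y.
Proof.
move=> x_neq0 y_neq0.
have -> : x = local_idele R x_neq0 p by rewrite /= dfwith_in.
have -> : y = local_idele R y_neq0 p by rewrite /= dfwith_in.
rewrite -[X in local_component _ X]/(
  (local_idele R x_neq0 * local_idele R y_neq0)%g p).
by rewrite -!restrict1E restrictM (hecke_mul X_hecke).
Qed.

End Character.
End Ideles.

(** * Dirichlet characters *)

Section DirichletCharacter.
Variables (R : realType) (N : nat) (chi : int -> R[i]).
Hypothesis chi_dirichlet : dirichlet_character N chi.

Lemma dirichlet1 : chi 1 = 1.
Proof.
have chi1_neq0 : chi 1 != 0.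
  by rewrite (dirichlet_support chi_dirichlet) /coprimez gcd1z.
by apply: (mulfI chi1_neq0); rewrite -(dirichlet_mul chi_dirichlet) !mulr1.
Qed.

Lemma dirichletX m k : chi (m ^+ k) = chi m ^+ k.
Proof.
elim: k => [|k IH]; first by rewrite expr0 dirichlet1.
by rewrite !exprS (dirichlet_mul chi_dirichlet) IH.
Qed.

Lemma dirichlet_prod (I : finType) (F : I -> nat) :
  chi (\prod_i F i)%N%:Z = \prod_i chi (F i)%:Z.
Proof.
apply: (big_morph (fun n : nat => chi n%:Z)); last exact: dirichlet1.
by move=> m n; rewrite PoszM (dirichlet_mul chi_dirichlet).
Qed.

End DirichletCharacter.

(** * The conductor of the character divides N *)

Section Conductor.
Variables (R : realType) (X : idele R -> R[i]) (N : nat) (chi : int -> R[i]).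
Hypothesis X_hecke : finite_order_hecke_character X.
Hypothesis chi_dirichlet : dirichlet_character N chi.
Hypothesis X_unramified : forall (p : prime_number) (x : padic p),
  ~~ (p %| N)%N -> Zp_unit x -> local_component X x = 1.
Hypothesis X_uniformizer : forall p : prime_number,
  ~~ (p %| N)%N -> local_component X (p%:R : padic p) = chi p%:Z.
Let N_gt0 : (0 < N)%N := dirichlet_modulus chi_dirichlet.
Let dvdN : pred prime_number := fun p => (p %| N)%N.

(** A basic neighbourhood of 1 on which [X] is trivial constrains only finitely
    many primes. Those prime to [N] are dropped because [X] is unramified
    there; those dividing [N] are met by a high enough power of [N]. *)
Lemma hecke_finite_level : exists M, [/\ (0 < M)%N, (N %| M)%N &
  forall y, congruence_idele N M y -> X y = 1].
Proof.
have [U [V [oU finU [box1 V1] XU]]] := hecke_trivial_box X_hecke.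
have [e Ue] := boolp.choice (fun p => oU p 1 (box1 p)).
have [s s_eq] := (finite_seqP _).1 finU.
(* A common exponent for the divisors of [N], found among the indices up to
   [N]; indices that are not prime count as 0. *)
pose E := \max_(i < N.+1) if insub (i : nat) is Some p then e p else 0%N.
exists (N ^ E.+1)%N; split; first by rewrite expn_gt0 N_gt0.
  by rewrite expnS dvdn_mulr.
move=> y [y_gt0 y_unit y_cong].
rewrite -(hecke_restrictT X_hecke y_gt0).
rewrite -(@hecke_drop _ _ X_hecke [seq p <- s | ~~ dvdN p]); last first.
  move=> p; rewrite mem_filter => /andP[p_ndvd _].
  by rewrite restrict1E; apply: X_unramified p_ndvd (y_unit p p_ndvd).
(* Dropped components are 1, which the box contains. *)
apply: XU; split=> [p|] //=; rewrite mem_filter.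
have [p_dvd|p_ndvd] /= := boolP (dvdN p); last first.
  case: ifP => [p_notin|_]; last exact: box1.
  have -> : U p = @Zp_unit p; last exact: y_unit.
  apply: contrapT => Up; suff: p \in s by rewrite (negbTE p_notin).
  by have : [set` s]%classic p by rewrite -s_eq.
have [z ->] := y_cong p p_dvd.
have le_eE : (e p <= E)%N.
  have lt_pN : (p < N.+1)%N by rewrite ltnS dvdn_leq.
  have := @leq_bigmax _ (fun i : 'I_N.+1 =>
    if insub (i : nat) is Some p then e p else 0%N) (Ordinal lt_pN).
  by rewrite /= (valK p).
have /dvdnP[c ->] : (p ^ e p %| N ^ E.+1)%N.
  apply: (@dvdn_trans (N ^ e p)); first exact: dvdn_exp2r.
  by apply: dvdn_exp2l; rewrite leqW.
have := Ue p (c%:R * z).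
by rewrite mulnC natrM natrX rmorphD rmorph1 !rmorphM rmorphXn
   !rmorph_nat -!mulrA.
Qed.

(** The principal idele [n] is the product of its components at the divisors
    of [N], of its component at [n] when [n] does not divide [N], and of an
    idele that is positive, a unit away from [N] and 1 at [N]. The character is
    trivial on the principal idele and on the last factor. *)
Lemma hecke_diagonal_prime n (n_gt0 : (0 < n)%N) :
  prime n ->
  X (restrict dvdN (diagonal R n_gt0)) *
    (if (n %| N)%N then 1 else chi n%:Z) = 1.
Proof.
move=> n_prime; have [M [_ _ XM]] := hecke_finite_level.
pose l := PrimeNumber n_prime; set D := diagonal R n_gt0.
have unit_off p : p != l -> Zp_unit (D p).
  move=> p_neq; apply: Zp_unit_nat; rewrite dvdn_prime2 ?prime_valP //.
have one_cong p : exists z : padic_int p, 1 = tofrac (1 + M%:R * z) :> padic p.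
  by exists 0; rewrite mulr0 addr0 rmorph1.
have XD : X D = 1.
  by apply: (hecke_principal X_hecke); apply: diagonal_principal.
have D_gt0 : 0 < inf_part D by rewrite ltr0n.
case: ifPn => [n_dvd|n_ndvd].
  rewrite mulr1; have := XM (D * (restrict dvdN D)^-1)%g.
  rewrite (hecke_mul X_hecke) (heckeV X_hecke) XD mul1r => XE.
  rewrite -[LHS]invrK XE ?invr1 //; split=> [|p p_ndvd|p p_dvd] /=.
  - by rewrite invr1 mulr1.
  - rewrite /dvdN (negbTE p_ndvd) invr1 mulr1; apply: unit_off.
    by apply: contra p_ndvd => /eqP ->.
  - by rewrite /dvdN p_dvd divff // diagonal_neq0.
have := XM (D * (restrict dvdN D * restrict (pred1 l) D)^-1)%g.
rewrite (hecke_mul X_hecke) (heckeV X_hecke) XD mul1r (hecke_mul X_hecke).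
rewrite restrict1E X_uniformizer // => XE.
rewrite -[LHS]invrK XE ?invr1 //; split=> [|p p_ndvd|p p_dvd] /=.
- by rewrite mulr1 invr1 mulr1.
- rewrite /dvdN (negbTE p_ndvd) mul1r; have [->|p_neq] := eqVneq p l.
    by rewrite divff ?diagonal_neq0 //; apply: Zp_unit1.
  by rewrite invr1 mulr1; apply: unit_off.
- rewrite /dvdN p_dvd; have [p_eq|_] := eqVneq p l.
    by move: n_ndvd; rewrite -[n]/(l : nat) -p_eq p_dvd.
  by rewrite mulr1 divff // diagonal_neq0.
Qed.

Lemma hecke_diagonal_coprime n (n_gt0 : (0 < n)%N) : coprime n N ->
  X (restrict dvdN (diagonal R n_gt0)) * chi n%:Z = 1.
Proof.
elim/ltn_ind: n n_gt0 => n IH n_gt0 co_nN.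
have [n_gt1|n_le1] := ltnP 1 n; last first.
  have n1 : n = 1%N by apply/eqP; rewrite eqn_leq n_le1.
  subst n; rewrite (dirichlet1 chi_dirichlet) mulr1 -(hecke1 X_hecke); congr X.
  by apply: ideleP => [p|] //=; rewrite if_same.
have p_prime := pdiv_prime n_gt1; set p := pdiv n in p_prime.
have p_gt0 := prime_gt0 p_prime.
have /dvdnP[m n_eq] : (p %| n)%N := pdiv_dvd n.
have m_gt0 : (0 < m)%N by move: n_gt0; rewrite n_eq muln_gt0 => /andP[].
have lt_mn : (m < n)%N.
  by rewrite n_eq -[X in (X < _)%N]muln1 ltn_pmul2l ?prime_gt1.
move: co_nN; rewrite {1}n_eq coprimeMl => /andP[co_mN co_pN].
move: n_gt0; rewrite n_eq => n_gt0.
rewrite (diagonalM R m_gt0 p_gt0) restrictM (hecke_mul X_hecke).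
rewrite PoszM (dirichlet_mul chi_dirichlet) mulrACA IH // mul1r.
have := hecke_diagonal_prime p_gt0 p_prime.
by rewrite -[(p %| N)%N]negbK -prime_coprime // co_pN.
Qed.

(** By the Chinese remainder theorem, [y] agrees at the divisors of [N] with a
    positive integer [n], up to an idele of a level [M] on which [X] is already
    known to be trivial. As [y] has level [N], [n] is 1 modulo [N], so that
    [chi n = 1]; hence [X] is trivial on the components of [n] at [N]. *)
Lemma hecke_conductor y : congruence_idele N N y -> X y = 1.
Proof.
move=> [y_gt0 y_unit y_cong]; have [M [M_gt0 N_dvdM XM]] := hecke_finite_level.
have /boolp.choice[c yc] : forall p : prime_number, exists n : nat,
    (p %| N)%N -> exists z : padic_int p,
    y p = tofrac (n%:R + (p ^ (logn p M).+1)%:R * z) /\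
    exists z' : padic_int p, n%:R + (p ^ (logn p M).+1)%:R * z = 1 + N%:R * z'.
  move=> p; have [p_dvd|] := boolP (p %| N)%N; last by exists 0%N.
  have [z yz] := y_cong p p_dvd.
  have [n [w nw]] := padic_int_approx (1 + N%:R * z) (logn p M).
  by exists n => _; exists w; rewrite -nw yz; split=> //; exists z.
pose s : seq prime_number := pmap insub (primes N).
have mem_s p : (p \in s) = (p %| N)%N.
  by rewrite mem_pmap_sub /= mem_primes prime_valP N_gt0.
(* The exponent exceeds the valuation of [M] by 1 only so that a digit of
   that precision exists. *)
have [|n n_gt0 nc] := @chinese_primes s c (fun p => (logn p M).+1).
  by rewrite pmap_sub_uniq ?primes_uniq.
have yn (p : prime_number) : (p %| N)%N -> exists z z' : padic_int p,
    [/\ y p = tofrac (n%:R + M%:R * z) & n%:R + M%:R * z = 1 + N%:R * z'].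
  move=> p_dvd; have [z [-> [z' z'E]]] := yc p p_dvd.
  have /esym cn := nc p (etrans (mem_s p) p_dvd).
  have [w cw] := nat_eqmod (padic_int p) cn.
  have [u pu] := padic_int_nat_dvd M_gt0 (leqnSn (logn p M)).
  have e : (c p)%:R + (p ^ (logn p M).+1)%:R * z = n%:R + M%:R * (u * (w + z)).
    by rewrite cw -addrA -mulrDr pu mulrA.
  by exists (u * (w + z)), z'; rewrite -e.
have n1 : n = 1 %[mod N].
  apply/eqP; rewrite eqn_mod_dvd //; apply/dvdn_partP => // p'.
  rewrite mem_primes => /and3P[p_prime _ p_dvd]; pose p := PrimeNumber p_prime.
  have [z [z' [_ nz]]] := yn p p_dvd; have [d M_eq] := dvdnP N_dvdM.
  rewrite p_part -[(n - 1)%N]absz_nat.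
  apply: (@padic_int_dvd_int p _ _ ((N`_p^')%N%:R * (z' - d%:R * z))).
  rewrite mulrA -natrM -p_part partnC // -pmulrn natrB // mulrBr.
  apply: (addIr (M%:R * z)); rewrite addrAC nz M_eq mulnC natrM -mulrA subrK.
  by rewrite addrC addKr.
have co_nN : coprime n N by rewrite -coprime_modl n1 coprime_modl coprime1n.
have chin : chi n%:Z = 1.
  rewrite -(dirichlet1 chi_dirichlet).
  apply: (dirichlet_periodic chi_dirichlet).
  by rewrite !modz_nat n1.
have XDn := hecke_diagonal_coprime n_gt0 co_nN; rewrite chin mulr1 in XDn.
have := XM (y * (restrict dvdN (diagonal R n_gt0))^-1)%g.
rewrite (hecke_mul X_hecke) (heckeV X_hecke) XDn invr1 mulr1; apply.
split=> [|p p_ndvd|p p_dvd] /=.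
- by rewrite invr1 mulr1.
- by rewrite /dvdN (negbTE p_ndvd) invr1 mulr1; apply: y_unit.
- have [z [_ [-> _]]] := yn p p_dvd; rewrite /dvdN p_dvd.
  have n_unit : (n%:R : padic_int p) \is a GRing.unit.
    apply: padic_int_nat_unit.
    by apply: coprime_dvdl p_dvd _; rewrite coprime_sym.
  exists (z / n%:R).
  have -> : 1 + M%:R * (z / n%:R) = (n%:R + M%:R * z) / n%:R.
    by rewrite mulrDl divrr // mulrA.
  by rewrite rmorphM rmorphV //= rmorph_nat.
Qed.

(** Powers of a prime dividing [N] contribute nothing, by
    [hecke_diagonal_prime]. *)
Lemma hecke_diagonal_level_part (q : prime_number) r m (m_gt0 : (0 < m)%N)
    (b_gt0 : (0 < q ^ r * m)%N) : (q %| N)%N -> coprime m N ->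
  X (restrict dvdN (diagonal R b_gt0)) * chi m%:Z = 1.
Proof.
move=> q_dvd co_mN; elim: r b_gt0 => [|r IH].
  by rewrite mul1n => b_gt0; apply: hecke_diagonal_coprime.
have q_gt0 := prime_gt0 (prime_valP q).
have b'_gt0 : (0 < q ^ r * m)%N by rewrite muln_gt0 expn_gt0 q_gt0.
rewrite expnS -mulnA => b_gt0; rewrite (diagonalM R q_gt0 b'_gt0) restrictM.
rewrite (hecke_mul X_hecke) -mulrA IH mulr1.
by have := hecke_diagonal_prime q_gt0 (prime_valP q); rewrite q_dvd mulr1.
Qed.

(** * Local components at an integer *)

Lemma local_component_unramified (q : prime_number) (a : int) :
  a != 0 -> ~~ (q %| N)%N ->
  local_component X (a%:~R : padic q) = chi q%:Z ^+ logn q `|a|%N.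
Proof.
move=> a_neq0 q_ndvd; have q_prime := prime_valP q.
have a_gt0 : (0 < `|a|)%N by rewrite absz_gt0.
have [m co_qm a_eq] := pfactor_coprime q_prime a_gt0.
have q_neq0 : q%:R != 0 :> padic q by rewrite diagonal_neq0 ?prime_gt0.
have m_unit : Zp_unit ((-1) ^+ (a < 0)%R * m%:R : padic q).
  apply: Zp_unitM; last by apply: Zp_unit_nat; rewrite -prime_coprime.
  exists ((-1) ^+ (a < 0)%R); first by rewrite unitrX ?unitrN1.
  by rewrite rmorphXn rmorphN1.
have Zp_unit_neq0 (x : padic q) : Zp_unit x -> x != 0.
  move=> [u u_unit ->]; rewrite tofrac_eq0.
  by apply: contraTneq u_unit => ->; rewrite unitr0.
have -> : a%:~R = ((-1) ^+ (a < 0)%R * m%:R) * q%:R ^+ logn q `|a| :> padic q.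
  rewrite -mulrA -natrX -natrM -a_eq [in LHS](intEsign a).
  by rewrite rmorphM rmorphXn rmorphN1.
have qr_neq0 r : q%:R ^+ r != 0 :> padic q by rewrite expf_neq0.
rewrite (local_componentM X_hecke (Zp_unit_neq0 _ m_unit) (qr_neq0 _)).
rewrite (X_unramified q_ndvd m_unit) mul1r.
elim: (logn q _) => [|r IH].
  by rewrite !expr0; apply: X_unramified q_ndvd (Zp_unit1 q).
by rewrite !exprS (local_componentM X_hecke) // IH X_uniformizer.
Qed.

(** The components of [b] at the divisors of [N] differ from the idele [a]
    placed at [q] by an idele of level [N]: this is what the congruences on [b]
    say. So both have the same image under [X], and the image of the former is
    given by [hecke_diagonal_level_part]. *)
Lemma local_component_ramified (q : prime_number) (a : int) (b : nat) :
  a != 0 -> (q %| N)%N -> (0 < b)%N ->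
  eqmod_padic q b%:Z a (a * N%:Z) ->
  (forall q' : prime_number, (q' %| N)%N -> q' <> q ->
     eqmod_padic q' b%:Z 1 N%:Z) ->
  forall m, b = (q ^ logn q `|a| * m)%N ->
  local_component X (a%:~R : padic q) = (chi m%:Z)^-1.
Proof.
move=> a_neq0 q_dvd b_gt0 [z ba] b1 m b_eq; have q_prime := prime_valP q.
have a_gt0 : (0 < `|a|)%N by rewrite absz_gt0.
have m_gt0 : (0 < m)%N by move: b_gt0; rewrite b_eq muln_gt0 => /andP[].
(* [b / a] is a unit at [q], so [b] has the same valuation there as [a]. *)
have q_ndvd_m : ~~ (q %| m)%N.
  apply/negP => /dvdnP[m' m_eq].
  have /dvdzP[a' a_eq] : ((q ^ logn q `|a|)%N%:Z %| a)%Z.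
    by rewrite dvdzE /= pfactor_dvdnn.
  have /dvdnP[N' N_eq] := q_dvd.
  suff : (q ^ (logn q `|a|).+1 %| `|a|)%N by rewrite pfactor_dvdn // ltnn.
  apply: (@padic_int_dvd_int q _ _ (m'%:R - a'%:~R * N'%:R * z)).
  have -> : a%:~R = b%:R - (a * N%:Z)%:~R * z :> padic_int q.
    by rewrite -ba opprB addrC subrK.
  rewrite mulrBr; congr (_ - _).
    rewrite -natrM b_eq m_eq; congr _%:R.
    by rewrite expnSr -mulnA [(m' * q)%N]mulnC.
  rewrite mulrA; congr (_ * _); rewrite {1}a_eq N_eq PoszM !rmorphM /= -!pmulrn.
  rewrite expnSr natrM mulrACA [RHS]mulrC mulrACA.
  by congr (_ * _); rewrite mulrC.
have co_mN : coprime m N.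
  rewrite coprime_has_primes //; apply/hasPn => p'.
  rewrite !mem_primes m_gt0 /= => /and3P[p_prime _ p_dvd].
  pose p := PrimeNumber p_prime; rewrite p_prime /=.
  have [p_eq|/eqP p_neq] := eqVneq p q.
    by rewrite -[p']/(p : nat) p_eq.
  have [w bw] := b1 p p_dvd p_neq; apply/negP => /dvdnP[k m_eq].
  have /dvdnP[N' N_eq] := p_dvd.
  suff : (p ^ 1 %| `|1%:Z|)%N
    by rewrite expn1 dvdn1 => /eqP p1; have := prime_valP p; rewrite p1.
  apply: (@padic_int_dvd_int p _ _ ((q ^ logn q `|a| * k)%:R - N'%:R * w)).
  have -> : 1%:~R = b%:R - N%:R * w :> padic_int p.
    by rewrite [N%:R]pmulrn -bw opprB addrC subrK.
  rewrite expn1 mulrBr b_eq m_eq N_eq mulrA -!natrM.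
  by rewrite [(p * N')%N]mulnC mulnA [X in _ = X%:R - _]mulnC.
have a_neq0' : a%:~R != 0 :> padic q.
  have : `|a|%N%:R != 0 :> padic q by apply: diagonal_neq0.
  rewrite [a in a%:~R](intEsign a) rmorphM /= -pmulrn rmorphXn rmorphN1.
  by rewrite mulf_eq0 signr_eq0.
set D := restrict dvdN (diagonal R b_gt0).
have XD : X D * chi m%:Z = 1.
  move: (b_gt0) @D; rewrite b_eq => b'_gt0; exact: hecke_diagonal_level_part.
have : X (D * (local_idele R a_neq0')^-1)%g = 1.
  apply: hecke_conductor; split=> [|p p_ndvd|p p_dvd] /=.
  - by rewrite invr1 mulr1.
  - have q_neq : q != p by apply: contraNneq p_ndvd => <-.
    by rewrite dfwith_out // /dvdN (negbTE p_ndvd) invr1 mulr1; apply: Zp_unit1.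
  rewrite /dvdN p_dvd; have [p_eq|q_neq] := eqVneq q p.
    subst p; rewrite dfwith_in; exists z; apply: (canLR (mulfK a_neq0')).
    rewrite -(rmorph_int (@tofrac _)) -(rmorph_nat (@tofrac _)) -rmorphM.
    congr tofrac; rewrite mulrDl mul1r.
    rewrite [b%:R]pmulrn -[LHS](subrK a%:~R) ba rmorphM /= -pmulrn addrC.
    by congr (_ + _); rewrite -mulrA mulrC.
  rewrite dfwith_out // invr1 mulr1.
  have [w bw] := b1 p p_dvd (fun e => elimN eqP q_neq (esym e)).
  exists w; rewrite -(rmorph_nat (@tofrac _)); congr tofrac.
  by rewrite [N%:R]pmulrn -bw addrC subrK.
rewrite (hecke_mul X_hecke) (heckeV X_hecke) => XDa.
have -> : local_component X (a%:~R : padic q) = X (local_idele R a_neq0').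
  rewrite /local_component; case: pselect => [h|//].
  by congr X; apply: ideleP.
rewrite -[LHS]mul1r -XDa divfK ?hecke_neq0 //.
rewrite -[RHS]mul1r -XD mulfK //; apply: contra_eq_neq XD => ->.
by rewrite mulr0 eq_sym oner_neq0.
Qed.

End Conductor.

(** * Dirichlet character and local components *)

Theorem proposition3p3 (R : realType) (N : nat) (chi : int -> R[i])
    (X : idele R -> R[i])
    (chi_dirichlet : dirichlet_character N chi)
    (X_hecke : finite_order_hecke_character X)
    (chi_X : corresponds X N chi)
    (a : int) (a_neq0 : a != 0) :
  (forall q : prime_number, ~~ (q %| N)%N ->
     local_component X (a%:~R : padic q) = chi q%:Z ^+ logn q `|a|%N)
  /\
  (forall (q : prime_number), (q %| N)%N ->
   forall b : nat, (0 < b)%N ->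
     eqmod_padic q b%:Z a (a * N%:Z) ->
     (forall q' : prime_number, (q' %| N)%N -> q' <> q ->
        eqmod_padic q' b%:Z 1 N%:Z) ->
   forall (s : nat) (l : 'I_s -> prime_number) (beta : 'I_s -> nat),
     injective l ->
     (forall j, 0 < beta j)%N ->
     b = (q ^ logn q `|a| * \prod_(j < s) l j ^ beta j)%N ->
     local_component X (a%:~R : padic q) =
       \prod_(j < s) chi (l j : nat)%:Z ^- beta j).
Proof.
have [M [chi' [[M_dvdN chi_eq] [_ ramified uniformizer]]]] := chi_X.
have ndvdM p : ~~ (p %| N)%N -> ~~ (p %| M)%N.
  by apply: contra => /dvdn_trans; apply.
have X_unramified (p : prime_number) (x : padic p) :
    ~~ (p %| N)%N -> Zp_unit x -> local_component X x = 1.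
  move=> /ndvdM/negP p_ndvd x_unit; apply/eqP/negPn/negP => Xx.
  by apply/p_ndvd/ramified; exists x.
have X_uniformizer (p : prime_number) : ~~ (p %| N)%N ->
    local_component X (p%:R : padic p) = chi p%:Z.
  move=> p_ndvd; rewrite -uniformizer ?ndvdM // chi_eq //.
  by rewrite coprimezE /= prime_coprime ?prime_valP.
split=> [q q_ndvd|q q_dvd b b_gt0 ba b1 s l beta _ _ b_eq].
  exact: (local_component_unramified X_hecke X_unramified X_uniformizer).
have dX := dirichletX chi_dirichlet.
rewrite (@local_component_ramified _ _ _ _ X_hecke chi_dirichlet
  X_unramified X_uniformizer q a b a_neq0 q_dvd b_gt0 ba b1 _ b_eq).
rewrite (dirichlet_prod chi_dirichlet) -prodfV.
by apply: eq_bigr => j _; rewrite -dX -natz natrX natz.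
Qed.
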